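(* Let $(X,\tau,h)$ be a premetric space such that $(X,\tau)$ is Hausdorff and $h$ satisfies (P1), (P2) and (P3). Let $S:X\rightrightarrows X$ be a set-valued map and let $M:=\{x_i\}_{i=1}^\infty$ be an infinite f-t-contractive $S$-orbit. Then $M$ is an $h$-contractive $S$-orbit.
   Context: A premetric space $(X,\tau,h)$ is a first countable topological space $(X,\tau)$ with a function $h:X\times X\to[0,\infty)$ satisfying (P1): $h(x,y)=0\Leftrightarrow x=y$. (No symmetry or triangle inequality is assumed.) Further properties: (P2) if $h(x,x_n)\to 0$, then $x_n\to x$; (P3) if $x_n\to x$, then $h(x_{n+1},x_n)\to 0$. A set-valued map $S:X\rightrightarrows X$ assigns to each $x\in X$ a (possibly empty) subset $S(x)\subseteq X$. An infinite $S$-orbit is a sequence $\{x_i\}_{i=1}^\infty$ with $x_{i+1}\in S(x_i)$ for all $i\ge1$. An infinite $S$-orbit $\{x_i\}_{i=1}^\infty$ is f-t-contractive (feebly topologically contractive) if for every open cover $\gamma$ of $X$ there exist $U\in\gamma$ and $i_0\in\mathbb{N}$ such that $x_{i_0}\in U$ and $S(x_{i_0})\subseteq U$. For nonempty $C\subseteq X$, $h_C(x):=\sup_{y\in C}h(y,x)$. An infinite $S$-orbit $\{x_i\}_{i=1}^\infty$ is $h$-contractive if it has a convergent subsequence $\{x_{i_k}\}_{k=1}^\infty$ with $h_{S(x_{i_k})}(x_{i_k})\to 0$ as $k\to\infty$. *)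

(* Defs.v *)
From HB Require Import structures.
From mathcomp Require Import all_boot all_order all_algebra.
From mathcomp Require Import all_classical all_reals all_analysis.
Import Order.TTheory GRing.Theory Num.Theory.
Import numFieldNormedType.Exports.

Set Implicit Arguments.
Unset Strict Implicit.
Unset Printing Implicit Defensive.

Local Open Scope classical_set_scope.
Local Open Scope ring_scope.

Section Premetric.
Context {R : realType} {X : topologicalType}.
Implicit Types (h : X -> X -> R) (S : X -> set X) (x : nat -> X).

Definition first_countable := forall a : X,
  exists2 B : set (set X), countable B &
    B `<=` nbhs a /\ forall U, nbhs a U -> exists2 V, B V & V `<=` U.

Definition P1 h := forall a b, h a b = 0 <-> a = b.

Definition P2 h := forall (a : X) x, h a (x n) @[n --> \oo] --> (0 : R) ->
  x n @[n --> \oo] --> a.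

Definition P3 h := forall (a : X) x, x n @[n --> \oo] --> a ->
  h (x n.+1) (x n) @[n --> \oo] --> (0 : R).

Record premetric h : Prop := Premetric {
  premetric_first_countable : first_countable;
  premetric_ge0 : forall a b, 0 <= h a b;
  premetric_P1 : P1 h }.

Definition infinite_orbit S x := forall i, S (x i) (x i.+1).

Definition ft_contractive_orbit S x := infinite_orbit S x /\
  forall gamma : set (set X), gamma `<=` open -> cover gamma id = setT ->
    exists2 U, gamma U & exists i, U (x i) /\ S (x i) `<=` U.

(* The supremum is taken in the extended reals, since [h] may be unbounded on
   [C]. It is meaningful only for nonempty [C], as [ereal_sup set0 = -oo];
   along an infinite orbit the sets [S (x i)] are nonempty. *)
Definition hsup h (C : set X) (a : X) : \bar R :=
  ereal_sup [set (h b a)%:E | b in C].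

Definition h_contractive_orbit h S x := infinite_orbit S x /\
  exists f : nat -> nat, [/\ increasing_seq f,
    exists l : X, x (f k) @[k --> \oo] --> l &
    hsup h (S (x (f k))) (x (f k)) @[k --> \oo] --> (0 : R)%:E].

End Premetric.

Arguments first_countable : clear implicits.

(* Main.v *)
(** Some point [a] has the property that every neighbourhood [U] of [a]
    contains [x i] and [S (x i)] for some [i], since otherwise the open sets
    violating this would form a cover contradicting f-t-contractivity.  Such
    indices [i] can be found arbitrarily far along the orbit, so a countable
    neighbourhood base of [a] yields a subsequence [x (f k)] for which both
    [x (f k)] and any selection [y k] of [S (x (f k))] converge to [a].  Applying
    (P3) to the interleaved sequence [x (f 0), y 0, x (f 1), y 1, ...] gives
    [h (y k) (x (f k)) --> 0]; choosing [y k] to violate a given bound whenever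
    possible, the suprema tend to [0]. *)

Require Import Defs.
From mathcomp Require Import all_boot all_order all_algebra.
From mathcomp Require Import all_classical all_reals all_analysis.
Import Order.TTheory GRing.Theory Num.Theory.
Import numFieldNormedType.Exports.

Local Open Scope classical_set_scope.

Lemma first_countable_nbhs_seq (X : topologicalType) (a : X) :
  first_countable X ->
  exists U : nat -> set X, (forall k, nbhs a (U k)) /\
    forall V, nbhs a V -> \forall k \near \oo, U k `<=` V.
Proof.
move=> /(_ a)[B /countable_injP[g g_inj] [B_nbhs B_base]].
(* [W n] is the member of [B] with code [n], or the whole space when no member has that code, since
   the condition is then vacuous. *)
pose W n : set X := [set y | forall V, B V -> g V = n -> V y].
have W_nbhs n : nbhs a (W n).
  have [[V [BV gV]]|noV] := pselect (exists V, B V /\ g V = n).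
    apply: filterS (B_nbhs _ BV) => y Vy V' BV' gV'.
    suff -> : V' = V by [].
    by apply: g_inj; rewrite ?inE// gV gV'.
  apply: filterS filterT => y _ V BV gV.
  by exfalso; apply: noV; exists V.
(* Intersecting [W 0], ..., [W k] makes the sequence decreasing, so an inclusion in [V] persists
   from the code of a base set inside [V] onwards. *)
exists (fun k => [set y | forall n, (n <= k)%N -> W n y]); split.
  elim=> [|k IHk].
    by apply: filterS (W_nbhs 0%N) => y Wy n; rewrite leqn0 => /eqP ->.
  apply: filterS (filterI IHk (W_nbhs k.+1)) => y [Uy Wy] n.
  by rewrite leq_eqVlt => /predU1P[->//|]; exact: Uy.
move=> V /B_base[V' BV' V'V].
apply: filterS (nbhs_infty_ge (g V')) => k gk y Uy.
by apply: V'V; apply: (Uy (g V')).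
Qed.

Lemma accessible_nbhs_eq (X : topologicalType) (a b : X) :
  accessible_space X -> (forall V, nbhs a V -> V b) -> b = a.
Proof.
move=> accX nab; apply: contrapT => ba.
have ab : a != b by apply/eqP => ab; apply: ba.
have [A [oA]] := accX _ _ ab; move=> /set_mem Aa /set_mem nAb.
by apply: nAb; apply: nab; apply: open_nbhs_nbhs; split.
Qed.

Section Orbit.
Context {X : topologicalType} (S : X -> set X) (x : nat -> X).

Lemma ft_contractive_cluster_point :
  ft_contractive_orbit S x ->
  exists a : X, forall U, nbhs a U -> exists i, U (x i) /\ S (x i) `<=` U.
Proof.
move=> [_ x_ft]; apply: contrapT => noa.
pose gamma : set (set X) :=
  [set U | open U /\ ~ exists i, U (x i) /\ S (x i) `<=` U].
have [||U [_ nU] /nU//] := x_ft gamma; first by move=> U [].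
apply/seteqP; split=> // a _; apply: contrapT => ga; apply: noa.
exists a => U; rewrite nbhsE => -[V [oV Va] VU]; apply: contrapT => nU.
apply: ga; exists V => //; split=> // -[i [Vi SV]].
by apply: nU; exists i; split; [exact: VU|exact: subset_trans VU].
Qed.

(* If index [N] itself works for every neighbourhood, then [x N = a] and
   [S a = [set a]], so the orbit is constant from [N] on. *)
Lemma cluster_point_frequently (a : X) :
  accessible_space X -> infinite_orbit S x ->
  (forall U, nbhs a U -> exists i, U (x i) /\ S (x i) `<=` U) ->
  forall N U, nbhs a U -> exists i, [/\ (N <= i)%N, U (x i) & S (x i) `<=` U].
Proof.
move=> accX orb clus; elim=> [|N IHN] U Ua.
  by have [i [? ?]] := clus _ Ua; exists i.
have [always|] := pselect (forall V, nbhs a V -> V (x N) /\ S (x N) `<=` V).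
  have xNa : x N = a.
    by apply: accessible_nbhs_eq => // V /always[].
  have xSNa : x N.+1 = a.
    by apply: accessible_nbhs_eq => // V /always[_]; apply; exact: orb.
  exists N.+1; rewrite xSNa -xNa; split=> //; first by case: (always _ Ua).
  by case: (always _ Ua).
(* Index [N] fails for some [V]; applying [IHN] to the intersection of [U] and [V] therefore yields
   an index other than [N]. *)
move=> /existsNP[V /not_implyP[Va nV]].
have [i [Ni [Ui Vi] SUV]] := IHN _ (filterI Ua Va).
exists i; split=> //; last by move=> y /SUV[].
rewrite ltn_neqAle Ni andbT; apply/eqP => NiE; apply: nV.
by rewrite NiE; split=> // y /SUV[].
Qed.

Lemma increasing_shrinking_subseq (a : X) :
  first_countable X ->
  (forall N U, nbhs a U ->
    exists i, [/\ (N <= i)%N, U (x i) & S (x i) `<=` U]) ->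
  exists2 f : nat -> nat, increasing_seq f &
    forall U, nbhs a U ->
      \forall k \near \oo, U (x (f k)) /\ S (x (f k)) `<=` U.
Proof.
move=> fcX freq; have [U [U_nbhs U_base]] := first_countable_nbhs_seq X a fcX.
have /choice[c cP] (p : nat * nat) : exists i,
    [/\ (p.2 <= i)%N, U p.1 (x i) & S (x i) `<=` U p.1].
  exact: freq.
(* The first component selects the neighbourhood [U k]; the lower bound [(f j).+1] makes [f]
   strictly increasing. *)
pose f := fix f k := if k is j.+1 then c (k, (f j).+1) else c (0%N, 0%N).
exists f; first by apply/increasing_seqP => n; case: (cP (n.+1, (f n).+1)).
move=> V /U_base; apply: filterS => k UV.
have [Uk SU] : U k (x (f k)) /\ S (x (f k)) `<=` U k.
  by case: k {UV} => [|k] /=; [case: (cP (0%N, 0%N))|case: (cP (k.+1, (f k).+1))].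
by split; [exact: UV|exact: subset_trans UV].
Qed.

End Orbit.

Lemma P3_cvg_pair (R : realType) (X : topologicalType) (h : X -> X -> R)
    (a : X) (u v : nat -> X) :
  P3 h -> u n @[n --> \oo] --> a -> v n @[n --> \oo] --> a ->
  h (v n) (u n) @[n --> \oo] --> (0 : R)%R.
Proof.
move=> h_P3 ua va.
pose z n := if odd n then v n./2 else u n./2.
have za : z n @[n --> \oo] --> a.
  move=> W Wa; have [N _ NP] : \forall n \near \oo, W (u n) /\ W (v n).
    by apply: filterI; [exact: ua|exact: va].
  exists N.*2 => // n /= Nn.
  have [Wu Wv] : W (u n./2) /\ W (v n./2).
    by apply: NP; rewrite /= -[N]doubleK half_leq.
  by rewrite /z; case: ifP.
move=> W /(h_P3 _ _ za)[N _ NP]; exists N => // n /= Nn.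
(* At the even index [n.*2], the consecutive terms of [z] are [u n] and then [v n]. *)
have := NP n.*2; rewrite /= /z /= odd_double /= uphalf_double doubleK; apply.
by rewrite (leq_trans Nn)// -addnn leq_addr.
Qed.

Lemma hsup_cvg0 (R : realType) (X : topologicalType) (h : X -> X -> R)
    (a : X) (u : nat -> X) (C : nat -> set X) :
  (forall b c, 0 <= h b c)%R -> P3 h -> (forall k, C k !=set0) ->
  (forall U, nbhs a U -> \forall k \near \oo, U (u k) /\ C k `<=` U) ->
  hsup h (C k) (u k) @[k --> \oo] --> (0 : R)%:E.
Proof.
move=> h_ge0 h_P3 C0 uC.
have ua : u k @[k --> \oo] --> a by move=> U /uC; apply: filterS => k [].
have hsup_ge0 k : (0 <= hsup h (C k) (u k))%E.
  have [b Cb] := C0 k; apply: (@le_trans _ _ (h b (u k))%:E).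
    by rewrite lee_fin.
  by apply: ereal_sup_ubound; exists b.
have hsup_le (e : R) : (0 < e)%R ->
    \forall k \near \oo, (hsup h (C k) (u k) <= e%:E)%E.
  move=> e0.
  (* [y k] exceeds the bound [e] if any point of [C k] does, so bounding [h] at [y k] alone bounds
     it on all of [C k]. *)
  have /choice[y yP] k : exists b, C k b /\
      ((h b (u k) <= e)%R -> forall c, C k c -> (h c (u k) <= e)%R).
    have [[b [Cb hb]]|nob] := pselect (exists b, C k b /\ (e < h b (u k))%R).
      by exists b; split=> //; rewrite leNgt hb.
    have [b Cb] := C0 k; exists b; split=> // _ c Cc.
    by rewrite leNgt; apply/negP => ec; apply: nob; exists c.
  have ya : y k @[k --> \oo] --> a.
    by move=> U /uC; apply: filterS => k [_]; apply; case: (yP k).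
  have /cvgrPdist_le /(_ e e0) := P3_cvg_pair _ _ _ _ _ _ h_P3 ua ya.
  apply: filterS => k; rewrite sub0r normrN ger0_norm// => hy.
  by apply: ge_ereal_sup => _ [c Cc <-]; rewrite lee_fin; apply: (yP k).2.
(* The bound with [e = 1] makes the suprema eventually finite, which reduces the limit to one of
   real numbers. *)
apply/fine_cvgP; split.
  apply: filterS (hsup_le _ (@ltr01 R)) => k h1.
  by rewrite ge0_fin_numE// (le_lt_trans h1)// ltry.
apply/cvgrPdist_le => e /hsup_le; apply: filterS => k he /=.
rewrite sub0r normrN ger0_norm ?fine_ge0// -lee_fin fineK//.
by rewrite ge0_fin_numE// (le_lt_trans he)// ltry.
Qed.

Theorem proposition5p7 (R : realType) (X : topologicalType) (h : X -> X -> R)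
    (h_premetric : premetric h) (X_hausdorff : hausdorff_space X)
    (h_P2 : P2 h) (h_P3 : P3 h)
    (S : X -> set X) (x : nat -> X) (x_ft : ft_contractive_orbit S x) :
  h_contractive_orbit h S x.
Proof.
have orb := x_ft.1; split=> //.
have accX := hausdorff_accessible X_hausdorff.
have [a clus] := ft_contractive_cluster_point S x x_ft.
have freq := cluster_point_frequently S x a accX orb clus.
have [fcX h_ge0 _] := h_premetric.
have [f f_inc fP] := increasing_shrinking_subseq S x a fcX freq.
exists f; split=> //.
  by exists a => U /fP; apply: filterS => k [].
apply: (hsup_cvg0 _ _ _ a) => // k.
by exists (x (f k).+1); exact: orb.
Qed.
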